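(* Let $\mu$ and $\nu$ be permutons. Then $I_\mu\subseteq I_\nu$ if and only if $\mu([0,a]\times[0,b])\leq\nu([0,a]\times[0,b])$ for all $0<a,b<1$.
   Context: Let $\Bbbk$ be an algebraically closed field. $\Lambda_{\mathbb{R}}$ is the $\Bbbk$-linear category with objects the real numbers (plus a zero object) generated by morphisms $\alpha_{yx}:x\to y$ and $\alpha^*_{xy}:y\to x$ for $x<y$, with $\alpha_{xx}=\alpha^*_{xx}=1_x$, subject to: (1) $\alpha_{zy}\alpha_{yx}=\alpha_{zx}$ and $\alpha^*_{xy}\alpha^*_{yz}=\alpha^*_{xz}$ for $x\le y\le z$; (2) $\alpha^*_{x+a-b,x+a}\alpha_{x+a,x}=\alpha_{x+a-b,x-b}\alpha^*_{x-b,x}$ for $a,b>0$. $\Lambda=\Lambda_{(0,1)}$ is the quotient category of $\Lambda_{\mathbb{R}}$ obtained by setting every object $x\notin(0,1)$ isomorphic to zero. A morphism of $\Lambda$ is path like if it is a nonzero composition of $\alpha$'s and $\alpha^*$'s; the length of $\alpha_{yx}$ and of $\alpha^*_{xy}$ is $|x-y|$ and the length of a composition is the sum of the lengths. Path like morphisms $x\to y$ are determined by their length and form a basis of $\operatorname{Hom}_\Lambda(x,y)$. $P_y=\operatorname{Hom}_\Lambda(y,-)$ for $y\in(0,1)$. A permuton is a measure $\mu$ on the Borel sets of $[0,1]\times[0,1]$ with $\mu([0,k]\times[0,1])=k=\mu([0,1]\times[0,k])$ for all $k\in[0,1]$. For $y\in(0,1)$ let $f_{\mu,y}(x)=-2\mu([0,x]\times[0,y])+y+x$,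 and let $D_{f_{\mu,y}}\subseteq P_y$ be the submodule with $D_{f_{\mu,y}}(x)$ spanned by the path like morphisms $y\to x$ of length at least $f_{\mu,y}(x)$. The permuton ideal is $I_\mu=\bigoplus_{y\in(0,1)}D_{f_{\mu,y}}\subseteq\bigoplus_{y\in(0,1)}P_y$. *)

(* Defs.v *)
From HB Require Import structures.
From mathcomp Require Import all_boot all_order all_algebra.
From mathcomp Require Import all_classical all_reals all_analysis.
From mathcomp Require Import ring lra.

Set Implicit Arguments.
Unset Strict Implicit.
Unset Printing Implicit Defensive.

Import Order.TTheory GRing.Theory Num.Theory.
Import numFieldNormedType.Exports.

Local Open Scope classical_set_scope.
Local Open Scope ring_scope.
Local Open Scope quotient_scope.

(** A type with operations satisfying the module laws up to an equivalence
    relation; its quotient [plquot] is an lmodType. *)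

Record prelmod (k : pzRingType) := Prelmod {
  pl_sort :> Type;
  pl_eq : pl_sort -> pl_sort -> Prop;
  pl_zero : pl_sort;
  pl_opp : pl_sort -> pl_sort;
  pl_add : pl_sort -> pl_sort -> pl_sort;
  pl_scale : k -> pl_sort -> pl_sort;
  pl_refl : forall u, pl_eq u u;
  pl_sym : forall u v, pl_eq u v -> pl_eq v u;
  pl_trans : forall u v w, pl_eq u v -> pl_eq v w -> pl_eq u w;
  pl_opp_cong : forall u v, pl_eq u v -> pl_eq (pl_opp u) (pl_opp v);
  pl_add_cong : forall u u' v v',
    pl_eq u u' -> pl_eq v v' -> pl_eq (pl_add u v) (pl_add u' v');
  pl_scale_cong : forall c u v,
    pl_eq u v -> pl_eq (pl_scale c u) (pl_scale c v);
  pl_addA : forall u v w,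
    pl_eq (pl_add u (pl_add v w)) (pl_add (pl_add u v) w);
  pl_addC : forall u v, pl_eq (pl_add u v) (pl_add v u);
  pl_add0 : forall u, pl_eq (pl_add pl_zero u) u;
  pl_addN : forall u, pl_eq (pl_add (pl_opp u) u) pl_zero;
  pl_scaleA : forall a b u,
    pl_eq (pl_scale a (pl_scale b u)) (pl_scale (a * b) u);
  pl_scale1 : forall u, pl_eq (pl_scale 1 u) u;
  pl_scaleDr : forall a u v,
    pl_eq (pl_scale a (pl_add u v)) (pl_add (pl_scale a u) (pl_scale a v));
  pl_scaleDl : forall a b u,
    pl_eq (pl_scale (a + b) u) (pl_add (pl_scale a u) (pl_scale b u)) }.

Section QuotientModule.
Variables (k : pzRingType) (P : prelmod k).

Let T : Type := {classic P}.
Let T_choice : choiceType := {classic P}.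

Definition pl_eqb (u v : T_choice) : bool := `[< @pl_eq k P u v >].

Fact pl_eqb_equiv : equiv_class_of pl_eqb.
Proof.
split=> [u|u v|v u w].
- exact/asboolP/pl_refl.
- by apply/asboolP/asboolP; exact: pl_sym.
- move=> /asboolP uv /asboolP vw; apply/asboolP; exact: pl_trans uv vw.
Qed.

Canonical pl_equiv := EquivRelPack pl_eqb_equiv.

Definition plquot : Type := {eq_quot pl_equiv}.
HB.instance Definition _ := Choice.on plquot.

Definition plpi (u : P) : plquot := \pi_({eq_quot pl_equiv}) (u : T_choice).
Definition plrepr (q : plquot) : P := repr (q : {eq_quot pl_equiv}).

Lemma plreprK q : plpi (plrepr q) = q.
Proof. exact: (@reprK _ {eq_quot pl_equiv}). Qed.

Lemma plpiP u v : plpi u = plpi v <-> pl_eq u v.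
Proof.
split=> [/(@eqmodP _ _ _) /asboolP //|uv].
by apply/eqmodP; exact/asboolP.
Qed.

Lemma plreprP u : pl_eq (plrepr (plpi u)) u.
Proof. by apply/plpiP; rewrite plreprK. Qed.

Definition plq_zero := plpi (pl_zero P).
Definition plq_opp q := plpi (pl_opp (plrepr q)).
Definition plq_add q r := plpi (pl_add (plrepr q) (plrepr r)).
Definition plq_scale (c : k) q := plpi (pl_scale c (plrepr q)).

Lemma plq_oppE u : plq_opp (plpi u) = plpi (pl_opp u).
Proof. by apply/plpiP/pl_opp_cong/plreprP. Qed.

Lemma plq_addE u v : plq_add (plpi u) (plpi v) = plpi (pl_add u v).
Proof. by apply/plpiP/pl_add_cong; exact: plreprP. Qed.

Lemma plq_scaleE c u : plq_scale c (plpi u) = plpi (pl_scale c u).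
Proof. by apply/plpiP/pl_scale_cong/plreprP. Qed.

Fact plq_addA : associative plq_add.
Proof.
move=> p q r; rewrite -(plreprK p) -(plreprK q) -(plreprK r) !plq_addE.
exact/plpiP/pl_addA.
Qed.
Fact plq_addC : commutative plq_add.
Proof. by move=> p q; apply/plpiP/pl_addC. Qed.
Fact plq_add0 : left_id plq_zero plq_add.
Proof. by move=> p; rewrite -(plreprK p) plq_addE; exact/plpiP/pl_add0. Qed.
Fact plq_addN : left_inverse plq_zero plq_opp plq_add.
Proof.
by move=> p; rewrite -(plreprK p) plq_oppE plq_addE; exact/plpiP/pl_addN.
Qed.

HB.instance Definition _ :=
  GRing.isZmodule.Build plquot plq_addA plq_addC plq_add0 plq_addN.

Fact plq_scaleA a b q : plq_scale a (plq_scale b q) = plq_scale (a * b) q.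
Proof. by rewrite -(plreprK q) !plq_scaleE; exact/plpiP/pl_scaleA. Qed.
Fact plq_scale1 : left_id 1 plq_scale.
Proof. by move=> p; rewrite -(plreprK p) plq_scaleE; exact/plpiP/pl_scale1. Qed.
Fact plq_scaleDr : right_distributive plq_scale +%R.
Proof.
move=> a p q; rewrite -[p + q]/(plq_add p q) -[RHS]/(plq_add _ _).
rewrite -(plreprK p) -(plreprK q) plq_addE !plq_scaleE plq_addE.
exact/plpiP/pl_scaleDr.
Qed.
Fact plq_scaleDl q : {morph plq_scale^~ q : a b / a + b}.
Proof.
move=> a b; rewrite -[RHS]/(plq_add _ _) -(plreprK q) !plq_scaleE plq_addE.
exact/plpiP/pl_scaleDl.
Qed.

HB.instance Definition _ := GRing.Zmodule_isLmodule.Build k plquot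
  plq_scaleA plq_scale1 plq_scaleDr plq_scaleDl.

Lemma plpi0 : plpi (pl_zero P) = 0 :> plquot. Proof. by []. Qed.
Lemma plpiD u v : plpi (pl_add u v) = plpi u + plpi v :> plquot.
Proof. by rewrite -plq_addE. Qed.
Lemma plpiZ c u : plpi (pl_scale c u) = c *: plpi u :> plquot.
Proof. by rewrite -plq_scaleE. Qed.

End QuotientModule.

Record lincat (k : pzRingType) := Lincat {
  ob :> Type;
  hom : ob -> ob -> lmodType k;
  idm : forall x, hom x x;
  hcomp : forall x y z, hom y z -> hom x y -> hom x z;
  hcomp_idl : forall x y (f : hom x y), hcomp (idm y) f = f;
  hcomp_idr : forall x y (f : hom x y), hcomp f (idm x) = f;
  hcompA : forall w x y z (h : hom y z) (g : hom x y) (f : hom w x),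
    hcomp h (hcomp g f) = hcomp (hcomp h g) f;
  hcompDl : forall x y z (g g' : hom y z) (f : hom x y),
    hcomp (g + g') f = hcomp g f + hcomp g' f;
  hcompDr : forall x y z (g : hom y z) (f f' : hom x y),
    hcomp g (f + f') = hcomp g f + hcomp g f';
  hcompZl : forall x y z c (g : hom y z) (f : hom x y),
    hcomp (c *: g) f = c *: hcomp g f;
  hcompZr : forall x y z c (g : hom y z) (f : hom x y),
    hcomp g (c *: f) = c *: hcomp g f }.

Arguments hom {k} _ _ _.
Arguments idm {k _} _.
Arguments hcomp {k _ x y z} _ _.
Notation "g \oc f" := (hcomp g f) (at level 40, left associativity).

Record prelincat (k : pzRingType) := Prelincat {
  pob : Type;
  phom : pob -> pob -> prelmod k;
  pid : forall x, phom x x;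
  pcomp : forall x y z, phom y z -> phom x y -> phom x z;
  pcomp_cong : forall x y z (g g' : phom y z) (f f' : phom x y),
    pl_eq g g' -> pl_eq f f' -> pl_eq (pcomp g f) (pcomp g' f');
  pcomp_idl : forall x y (f : phom x y), pl_eq (pcomp (pid y) f) f;
  pcomp_idr : forall x y (f : phom x y), pl_eq (pcomp f (pid x)) f;
  pcompA : forall w x y z (h : phom y z) (g : phom x y) (f : phom w x),
    pl_eq (pcomp h (pcomp g f)) (pcomp (pcomp h g) f);
  pcompDl : forall x y z (g g' : phom y z) (f : phom x y),
    pl_eq (pcomp (pl_add g g') f) (pl_add (pcomp g f) (pcomp g' f));
  pcompDr : forall x y z (g : phom y z) (f f' : phom x y),
    pl_eq (pcomp g (pl_add f f')) (pl_add (pcomp g f) (pcomp g f'));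
  pcompZl : forall x y z c (g : phom y z) (f : phom x y),
    pl_eq (pcomp (pl_scale c g) f) (pl_scale c (pcomp g f));
  pcompZr : forall x y z c (g : phom y z) (f : phom x y),
    pl_eq (pcomp g (pl_scale c f)) (pl_scale c (pcomp g f)) }.

Section QuotientPrelincat.
Variables (k : pzRingType) (C : prelincat k).

Definition qhom (x y : pob C) : lmodType k := plquot (phom x y).
Definition qpi x y (f : phom x y) : qhom x y := plpi f.
Definition qcomp x y z (g : qhom y z) (f : qhom x y) : qhom x z :=
  plpi (pcomp (plrepr g) (plrepr f)).

Lemma qcompE x y z (g : phom y z) (f : phom x y) :
  qcomp (plpi g) (plpi f) = plpi (pcomp g f).
Proof. by apply/plpiP/pcomp_cong; exact: plreprP. Qed.

Fact qcomp_idl x y (f : qhom x y) : qcomp (plpi (pid y)) f = f.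
Proof. by rewrite -(plreprK f) qcompE; exact/plpiP/pcomp_idl. Qed.
Fact qcomp_idr x y (f : qhom x y) : qcomp f (plpi (pid x)) = f.
Proof. by rewrite -(plreprK f) qcompE; exact/plpiP/pcomp_idr. Qed.
Fact qcompA w x y z (h : qhom y z) (g : qhom x y) (f : qhom w x) :
  qcomp h (qcomp g f) = qcomp (qcomp h g) f.
Proof.
rewrite -(plreprK f) -(plreprK g) -(plreprK h) !qcompE.
exact/plpiP/pcompA.
Qed.
Fact qcompDl x y z (g g' : qhom y z) (f : qhom x y) :
  qcomp (g + g') f = qcomp g f + qcomp g' f.
Proof.
rewrite -(plreprK f) -(plreprK g) -(plreprK g') -plpiD !qcompE -plpiD.
exact/plpiP/pcompDl.
Qed.
Fact qcompDr x y z (g : qhom y z) (f f' : qhom x y) :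
  qcomp g (f + f') = qcomp g f + qcomp g f'.
Proof.
rewrite -(plreprK f) -(plreprK g) -(plreprK f') -plpiD !qcompE -plpiD.
exact/plpiP/pcompDr.
Qed.
Fact qcompZl x y z c (g : qhom y z) (f : qhom x y) :
  qcomp (c *: g) f = c *: qcomp g f.
Proof.
rewrite -(plreprK f) -(plreprK g) -plpiZ !qcompE -plpiZ.
exact/plpiP/pcompZl.
Qed.
Fact qcompZr x y z c (g : qhom y z) (f : qhom x y) :
  qcomp g (c *: f) = c *: qcomp g f.
Proof.
rewrite -(plreprK f) -(plreprK g) -plpiZ !qcompE -plpiZ.
exact/plpiP/pcompZr.
Qed.

Definition lincat_of : lincat k :=
  Lincat qcomp_idl qcomp_idr qcompA qcompDl qcompDr qcompZl qcompZr.

End QuotientPrelincat.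

(** The quotient of [C] by the two-sided ideal generated by [G]. *)
Section QuotientCategory.
Variables (k : pzRingType) (C : lincat k) (G : forall x y : C, set (hom C x y)).

Inductive ideal_gen : forall x y : C, hom C x y -> Prop :=
| ideal_gen_in x y (f : hom C x y) : G f -> ideal_gen f
| ideal_gen0 x y : ideal_gen (0 : hom C x y)
| ideal_genD x y (f g : hom C x y) :
    ideal_gen f -> ideal_gen g -> ideal_gen (f + g)
| ideal_genZ x y c (f : hom C x y) : ideal_gen f -> ideal_gen (c *: f)
| ideal_gen_compl x y z (g : hom C y z) (f : hom C x y) :
    ideal_gen f -> ideal_gen (g \oc f)
| ideal_gen_compr x y z (g : hom C y z) (f : hom C x y) :
    ideal_gen g -> ideal_gen (g \oc f).

Definition ideal_eq x y (f g : hom C x y) : Prop := ideal_gen (f - g).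

Lemma ideal_eq_refl' x y (f g : hom C x y) : f = g -> ideal_eq f g.
Proof. by move=> ->; rewrite /ideal_eq subrr; exact: ideal_gen0. Qed.
Fact ideal_eq_refl x y (f : hom C x y) : ideal_eq f f.
Proof. exact: ideal_eq_refl'. Qed.
Fact ideal_eq_sym x y (f g : hom C x y) : ideal_eq f g -> ideal_eq g f.
Proof. by move=> /(ideal_genZ (-1)); rewrite scaleN1r opprB. Qed.
Fact ideal_eq_trans x y (f g h : hom C x y) :
  ideal_eq f g -> ideal_eq g h -> ideal_eq f h.
Proof. by move=> fg /(ideal_genD fg); rewrite addrA subrK. Qed.
Fact ideal_eq_opp x y (f g : hom C x y) :
  ideal_eq f g -> ideal_eq (- f) (- g).
Proof.
by move=> /(ideal_genZ (-1)); rewrite scaleN1r /ideal_eq opprB opprK addrC.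
Qed.
Fact ideal_eq_add x y (f f' g g' : hom C x y) :
  ideal_eq f f' -> ideal_eq g g' -> ideal_eq (f + g) (f' + g').
Proof. by move=> ff' /(ideal_genD ff'); rewrite /ideal_eq opprD addrACA. Qed.
Fact ideal_eq_scale x y c (f g : hom C x y) :
  ideal_eq f g -> ideal_eq (c *: f) (c *: g).
Proof. by move=> /(ideal_genZ c); rewrite scalerBr. Qed.

Lemma hcompBl x y z (g g' : hom C y z) (f : hom C x y) :
  (g - g') \oc f = g \oc f - g' \oc f.
Proof. by rewrite -!scaleN1r hcompDl hcompZl. Qed.
Lemma hcompBr x y z (g : hom C y z) (f f' : hom C x y) :
  g \oc (f - f') = g \oc f - g \oc f'.
Proof. by rewrite -!scaleN1r hcompDr hcompZr. Qed.

Fact ideal_eq_comp x y z (g g' : hom C y z) (f f' : hom C x y) :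
  ideal_eq g g' -> ideal_eq f f' -> ideal_eq (g \oc f) (g' \oc f').
Proof.
move=> /(@ideal_gen_compr _ _ _ _ f) + /(@ideal_gen_compl _ _ _ g').
rewrite hcompBl hcompBr; exact: ideal_eq_trans.
Qed.

Definition qcat_phom (x y : C) : prelmod k.
Proof.
refine (@Prelmod k (hom C x y) (@ideal_eq x y) 0 -%R +%R *:%R
  (@ideal_eq_refl x y) (@ideal_eq_sym x y) (@ideal_eq_trans x y)
  (@ideal_eq_opp x y) (@ideal_eq_add x y) (@ideal_eq_scale x y)
  _ _ _ _ _ _ _ _) => *; apply: ideal_eq_refl'.
- exact: addrA.
- exact: addrC.
- exact: add0r.
- exact: addNr.
- exact: scalerA.
- exact: scale1r.
- exact: scalerDr.
- exact: scalerDl.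
Defined.

Definition qcat_pre : prelincat k.
Proof.
refine (@Prelincat k C qcat_phom (fun x => idm x)
  (fun x y z g f => hcomp g f) (@ideal_eq_comp) _ _ _ _ _ _ _) => /= *;
  apply: ideal_eq_refl'.
- exact: hcomp_idl.
- exact: hcomp_idr.
- exact: hcompA.
- exact: hcompDl.
- exact: hcompDr.
- exact: hcompZl.
- exact: hcompZr.
Defined.

Definition quotient_cat : lincat k := lincat_of qcat_pre.

Definition quotient_proj x y (f : hom C x y) : hom quotient_cat x y :=
  @qpi k qcat_pre x y f.

End QuotientCategory.

Section Lambda.
Variables (k : fieldType) (R : realType).

(** [Some x] is the real number [x], [None] the zero object. *)
Definition vertex : Type := option R.

(** Formal linear expressions in the generators; [Up x y] is alpha_{yx} and
    [Down x y] is alpha^*_{xy}. *)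
Inductive expr : vertex -> vertex -> Type :=
| Id x : expr x x
| Comp x y z : expr y z -> expr x y -> expr x z
| Zero x y : expr x y
| Add x y : expr x y -> expr x y -> expr x y
| Scale x y : k -> expr x y -> expr x y
| Up (x y : R) : x <= y -> expr (Some x) (Some y)
| Down (x y : R) : x <= y -> expr (Some y) (Some x).

(** The congruence generated by the axioms of a linear category, the vanishing
    of the zero object, and the defining relations of Lambda_R. *)
Inductive expr_eq : forall x y, expr x y -> expr x y -> Prop :=
| ee_refl x y (f : expr x y) : expr_eq f f
| ee_sym x y (f g : expr x y) : expr_eq f g -> expr_eq g f
| ee_trans x y (f g h : expr x y) :
    expr_eq f g -> expr_eq g h -> expr_eq f h
| ee_comp x y z (g g' : expr y z) (f f' : expr x y) :
    expr_eq g g' -> expr_eq f f' -> expr_eq (Comp g f) (Comp g' f')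
| ee_add x y (f f' g g' : expr x y) :
    expr_eq f f' -> expr_eq g g' -> expr_eq (Add f g) (Add f' g')
| ee_scale x y c (f f' : expr x y) :
    expr_eq f f' -> expr_eq (Scale c f) (Scale c f')
| ee_addA x y (f g h : expr x y) :
    expr_eq (Add f (Add g h)) (Add (Add f g) h)
| ee_addC x y (f g : expr x y) : expr_eq (Add f g) (Add g f)
| ee_add0 x y (f : expr x y) : expr_eq (Add (Zero x y) f) f
| ee_scale0 x y (f : expr x y) : expr_eq (Scale 0 f) (Zero x y)
| ee_scale1 x y (f : expr x y) : expr_eq (Scale 1 f) f
| ee_scaleA x y a b (f : expr x y) :
    expr_eq (Scale a (Scale b f)) (Scale (a * b) f)
| ee_scaleDr x y a (f g : expr x y) :
    expr_eq (Scale a (Add f g)) (Add (Scale a f) (Scale a g))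
| ee_scaleDl x y a b (f : expr x y) :
    expr_eq (Scale (a + b) f) (Add (Scale a f) (Scale b f))
| ee_idl x y (f : expr x y) : expr_eq (Comp (Id y) f) f
| ee_idr x y (f : expr x y) : expr_eq (Comp f (Id x)) f
| ee_compA w x y z (h : expr y z) (g : expr x y) (f : expr w x) :
    expr_eq (Comp h (Comp g f)) (Comp (Comp h g) f)
| ee_compDl x y z (g g' : expr y z) (f : expr x y) :
    expr_eq (Comp (Add g g') f) (Add (Comp g f) (Comp g' f))
| ee_compDr x y z (g : expr y z) (f f' : expr x y) :
    expr_eq (Comp g (Add f f')) (Add (Comp g f) (Comp g f'))
| ee_compZl x y z c (g : expr y z) (f : expr x y) :
    expr_eq (Comp (Scale c g) f) (Scale c (Comp g f))
| ee_compZr x y z c (g : expr y z) (f : expr x y) :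
    expr_eq (Comp g (Scale c f)) (Scale c (Comp g f))
| ee_zero_object : expr_eq (Id None) (Zero None None)
| ee_up_id x (xx : x <= x) : expr_eq (Up xx) (Id (Some x))
| ee_down_id x (xx : x <= x) : expr_eq (Down xx) (Id (Some x))
| ee_up_comp x y z (xy : x <= y) (yz : y <= z) (xz : x <= z) :
    expr_eq (Comp (Up yz) (Up xy)) (Up xz)
| ee_down_comp x y z (xy : x <= y) (yz : y <= z) (xz : x <= z) :
    expr_eq (Comp (Down xy) (Down yz)) (Down xz)
| ee_commute (x a b : R) (a0 : 0 < a) (b0 : 0 < b)
    (down1 : x + a - b <= x + a) (up1 : x <= x + a)
    (up2 : x - b <= x + a - b) (down2 : x - b <= x) :
    expr_eq (Comp (Down down1) (Up up1)) (Comp (Up up2) (Down down2)).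

Definition LambdaR_phom (x y : vertex) : prelmod k.
Proof.
refine (@Prelmod k (expr x y) (@expr_eq x y) (Zero x y) (Scale (-1))
  (@Add x y) (@Scale x y) (@ee_refl x y) (@ee_sym x y) (@ee_trans x y)
  (@ee_scale x y (-1)) (@ee_add x y) (@ee_scale x y)
  (@ee_addA x y) (@ee_addC x y) (@ee_add0 x y) _
  (@ee_scaleA x y) (@ee_scale1 x y) (@ee_scaleDr x y) (@ee_scaleDl x y)).
move=> f; apply: ee_trans (ee_scale0 f); rewrite -(addNr 1).
by apply: ee_sym; apply: ee_trans (ee_scaleDl _ _ _) _;
  apply: ee_add (ee_refl _) (ee_scale1 _).
Defined.

Definition LambdaR_pre : prelincat k :=
  @Prelincat k vertex LambdaR_phom Id Comp ee_comp ee_idl ee_idr ee_compA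
    ee_compDl ee_compDr ee_compZl ee_compZr.

Definition LambdaR : lincat k := lincat_of LambdaR_pre.

(** An object is zero if and only if its identity is, so Lambda is the quotient
    by the ideal generated by the identities of the reals outside (0,1). *)
Inductive outer_id : forall x y : LambdaR, hom LambdaR x y -> Prop :=
| OuterId (x : R) : ~ (0 < x < 1) -> @outer_id (Some x) (Some x) (idm _).

Definition Lambda : lincat k := quotient_cat outer_id.

Definition Lclass (x y : vertex) (f : expr x y) : hom Lambda x y :=
  @quotient_proj k LambdaR outer_id x y (@qpi k LambdaR_pre x y f).

Definition alpha (x y : R) (xy : x <= y) : hom Lambda (Some x) (Some y) :=
  Lclass (Up xy).
Definition alphas (x y : R) (xy : x <= y) : hom Lambda (Some y) (Some x) :=
  Lclass (Down xy).

(** [composite f l]: [f] is a composition of alphas and alpha^*s, of total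
    length [l]. *)
Inductive composite : forall x y : Lambda, hom Lambda x y -> R -> Prop :=
| composite_alpha (x y : R) (xy : x <= y) : composite (alpha xy) `|x - y|
| composite_alphas (x y : R) (xy : x <= y) : composite (alphas xy) `|x - y|
| composite_comp x y z (g : hom Lambda y z) (f : hom Lambda x y) l m :
    composite g l -> composite f m -> composite (g \oc f) (l + m).

(** [path_like f l]: [f] is path like, of length [l]. *)
Definition path_like (x y : Lambda) (f : hom Lambda x y) (l : R) : Prop :=
  f <> 0 /\ composite f l.

Lemma LclassP (x y : Lambda) (f : hom Lambda x y) :
  exists e : expr x y, f = Lclass e.
Proof.
exists (plrepr (plrepr f : hom LambdaR x y)).
by rewrite /Lclass /quotient_proj /qpi plreprK plreprK.
Qed.

End Lambda.

(** Covariant linear functors. *)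
Record cmod (k : pzRingType) (C : lincat k) := Cmod {
  cm_ob :> C -> lmodType k;
  cm_act : forall x y, hom C x y -> cm_ob x -> cm_ob y;
  cm_act_id : forall x v, cm_act (idm x) v = v;
  cm_act_comp : forall x y z (g : hom C y z) (f : hom C x y) v,
    cm_act (g \oc f) v = cm_act g (cm_act f v);
  cm_actDl : forall x y (f g : hom C x y) v,
    cm_act (f + g) v = cm_act f v + cm_act g v;
  cm_actZl : forall x y c (f : hom C x y) v,
    cm_act (c *: f) v = c *: cm_act f v;
  cm_actDr : forall x y (f : hom C x y) u v,
    cm_act f (u + v) = cm_act f u + cm_act f v;
  cm_actZr : forall x y c (f : hom C x y) v,
    cm_act f (c *: v) = c *: cm_act f v }.

Record submodule (k : pzRingType) (C : lincat k) (M : cmod C) := Submodule {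
  sm_set :> forall x, set (M x);
  sm0 : forall x, @sm_set x 0;
  smD : forall x u v, @sm_set x u -> @sm_set x v -> @sm_set x (u + v);
  smZ : forall x c v, @sm_set x v -> @sm_set x (c *: v);
  sm_act : forall x y (f : hom C x y) v,
    @sm_set x v -> @sm_set y (cm_act f v) }.

Arguments sm_set {k C M} _ _ _.

Definition sub_le (k : pzRingType) (C : lincat k) (M : cmod C)
  (S T : submodule M) : Prop := forall x, S x `<=` T x.

Definition representable (k : pzRingType) (C : lincat k) (y : C) : cmod C :=
  @Cmod k C (hom C y) (fun _ _ g f => g \oc f)
    (@hcomp_idl k C y) (fun _ _ _ h g f => esym (hcompA h g f))
    (fun _ _ g g' f => hcompDl g g' f) (fun _ _ c g f => hcompZl c g f)
    (fun _ _ g f f' => hcompDr g f f') (fun _ _ c g f => hcompZr c g f).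

Section FinitelySupported.
Variables (k : pzRingType) (I : Type) (V : I -> lmodType k).

Definition fs_family : Type :=
  {v : forall i, V i | finite_set [set i | v i <> 0]}.
HB.instance Definition _ := gen_eqMixin fs_family.
HB.instance Definition _ := gen_choiceMixin fs_family.

Definition fs_val (v : fs_family) : forall i, V i := proj1_sig v.

Lemma fs_valP (u v : fs_family) :
  (forall i, fs_val u i = fs_val v i) -> u = v.
Proof.
case: u v => [u uf] [v vf] /= uv; apply: eq_exist.
exact: functional_extensionality_dep.
Qed.

Fact fs_fin0 : finite_set [set i | (0 : V i) <> 0].
Proof. by rewrite (_ : [set i | _] = set0) // -subset0 => i /=; apply. Qed.
Fact fs_finN (u : fs_family) : finite_set [set i | - fs_val u i <> 0].
Proof.
by apply: sub_finite_set (proj2_sig u) => i /= + u0; rewrite /fs_val u0 oppr0.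
Qed.
Fact fs_finD (u v : fs_family) :
  finite_set [set i | fs_val u i + fs_val v i <> 0].
Proof.
have: finite_set ([set i | fs_val u i <> 0] `|` [set i | fs_val v i <> 0]).
  by rewrite finite_setU; split; [exact: proj2_sig u|exact: proj2_sig v].
apply: sub_finite_set => i /= uv.
have [u0|] := pselect (fs_val u i = 0); last by left.
by right=> v0; apply: uv; rewrite u0 v0 addr0.
Qed.
Fact fs_finZ c (u : fs_family) : finite_set [set i | c *: fs_val u i <> 0].
Proof.
by apply: sub_finite_set (proj2_sig u) => i /= + u0; rewrite /fs_val u0 scaler0.
Qed.

Definition fs_zero : fs_family := exist _ (fun=> 0) fs_fin0.
Definition fs_opp u : fs_family := exist _ (fun i => - fs_val u i) (fs_finN u).
Definition fs_add u v : fs_family :=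
  exist _ (fun i => fs_val u i + fs_val v i) (fs_finD u v).
Definition fs_scale c u : fs_family :=
  exist _ (fun i => c *: fs_val u i) (fs_finZ c u).

Fact fs_addA : associative fs_add.
Proof. by move=> u v w; apply: fs_valP => i; exact: addrA. Qed.
Fact fs_addC : commutative fs_add.
Proof. by move=> u v; apply: fs_valP => i; exact: addrC. Qed.
Fact fs_add0 : left_id fs_zero fs_add.
Proof. by move=> u; apply: fs_valP => i; exact: add0r. Qed.
Fact fs_addN : left_inverse fs_zero fs_opp fs_add.
Proof. by move=> u; apply: fs_valP => i; exact: addNr. Qed.

HB.instance Definition _ :=
  GRing.isZmodule.Build fs_family fs_addA fs_addC fs_add0 fs_addN.

Fact fs_scaleA a b u : fs_scale a (fs_scale b u) = fs_scale (a * b) u.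
Proof. by apply: fs_valP => i; exact: scalerA. Qed.
Fact fs_scale1 : left_id 1 fs_scale.
Proof. by move=> u; apply: fs_valP => i; exact: scale1r. Qed.
Fact fs_scaleDr : right_distributive fs_scale +%R.
Proof. by move=> a u v; apply: fs_valP => i; exact: scalerDr. Qed.
Fact fs_scaleDl u : {morph fs_scale^~ u : a b / a + b}.
Proof. by move=> a b; apply: fs_valP => i; exact: scalerDl. Qed.

HB.instance Definition _ := GRing.Zmodule_isLmodule.Build k fs_family
  fs_scaleA fs_scale1 fs_scaleDr fs_scaleDl.

End FinitelySupported.

Section DirectSum.
Variables (k : pzRingType) (C : lincat k) (I : Type) (M : I -> cmod C).

Definition dsum_ob (x : C) : lmodType k := fs_family (fun i => M i x).

Lemma cm_act0 (N : cmod C) x y (f : hom C x y) : cm_act f (0 : N x) = 0.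
Proof. by rewrite -[0 in LHS](scale0r 0) cm_actZr scale0r. Qed.

Fact dsum_act_fin x y (f : hom C x y) (v : dsum_ob x) :
  finite_set [set i | cm_act f (fs_val v i) <> 0].
Proof.
by apply: sub_finite_set (proj2_sig v) => i /= + v0; rewrite /fs_val v0 cm_act0.
Qed.

Definition dsum_act x y (f : hom C x y) (v : dsum_ob x) : dsum_ob y :=
  exist _ (fun i => cm_act f (fs_val v i)) (dsum_act_fin f v).

Definition dsum : cmod C.
Proof.
refine (@Cmod k C dsum_ob dsum_act _ _ _ _ _ _) => *; apply: fs_valP => i.
- exact: cm_act_id.
- exact: cm_act_comp.
- exact: cm_actDl.
- exact: cm_actZl.
- exact: cm_actDr.
- exact: cm_actZr.
Defined.

Definition dsum_sub (S : forall i, submodule (M i)) : submodule dsum.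
Proof.
refine (@Submodule k C dsum (fun x => [set v | forall i, S i x (fs_val v i)])
  _ _ _ _) => /= *.
- by apply: sm0.
- by apply: smD.
- by apply: smZ.
- by apply: sm_act.
Defined.

End DirectSum.

Definition lin_span (k : pzRingType) (V : lmodType k) (S : set V) : set V :=
  [set v | exists (n : nat) (c : 'I_n -> k) (u : 'I_n -> V),
    (forall i, S (u i)) /\ v = \sum_(i < n) c i *: u i].

Section LinSpan.
Variables (k : pzRingType) (V : lmodType k).

Lemma lin_span0 (S : set V) : lin_span S 0.
Proof.
by exists 0%N, (fun=> 0), (fun=> 0); split => [[]//|]; rewrite big_ord0.
Qed.

Lemma lin_spanZ (S : set V) a v : lin_span S v -> lin_span S (a *: v).
Proof.
move=> [n [c [u [Su ->]]]]; exists n, (fun i => a * c i), u; split=> //.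
by rewrite scaler_sumr; apply: eq_bigr => i _; rewrite scalerA.
Qed.

Lemma lin_spanD (S : set V) u v :
  lin_span S u -> lin_span S v -> lin_span S (u + v).
Proof.
move=> [m [c [s [Ss ->]]]] [n [d [t [St ->]]]].
exists (m + n)%N,
  (fun i => match fintype.split i with inl j => c j | inr j => d j end),
  (fun i => match fintype.split i with inl j => s j | inr j => t j end).
split; first by move=> i; case: fintype.split.
rewrite big_split_ord /=; congr (_ + _); apply: eq_bigr => i _.
  by have := unsplitK (inl i : 'I_m + 'I_n)%type => /= ->.
by have := unsplitK (inr i : 'I_m + 'I_n)%type => /= ->.
Qed.

Lemma lin_span_in (S : set V) v : S v -> lin_span S v.
Proof.
move=> Sv; exists 1%N, (fun=> 1), (fun=> v); split=> //.
by rewrite big_ord1 scale1r.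
Qed.

Lemma lin_span_ind (S : set V) (Q : V -> Prop) :
  Q 0 -> (forall u v, Q u -> Q v -> Q (u + v)) ->
  (forall a v, S v -> Q (a *: v)) -> forall v, lin_span S v -> Q v.
Proof. by move=> Q0 QD QS v [n [c [u [Su ->]]]]; elim/big_ind: _ => // i _; exact: QS. Qed.

End LinSpan.

Section Cut.
Variables (k : fieldType) (R : realType).
Notation L := (Lambda k R).

Definition long_path (y : L) (f : R -> R) (x : L) : set (hom L y x) :=
  match x with
  | Some x => [set g | exists l : R, f x <= l /\ path_like g l]
  | None => set0
  end.

(** Ensures that the spans of [long_path] are stable under the action of
    Lambda. *)
Definition lipschitz1 (f : R -> R) : Prop :=
  forall x z, f z <= f x + `|x - z|.

Definition cut_set (y : L) (f : R -> R) (x : L) : set (hom L y x) :=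
  lin_span (@long_path y f x).
Arguments cut_set : clear implicits.

Lemma Lclass_comp x y z (g : expr k y z) (f : expr k x y) :
  Lclass (Comp g f) = (Lclass g : hom L y z) \oc (Lclass f : hom L x y).
Proof.
have h1 := @qcompE k (qcat_pre (@outer_id k R)) x y z
  (@qpi k (LambdaR_pre k R) y z g) (@qpi k (LambdaR_pre k R) x y f).
have h2 := @qcompE k (LambdaR_pre k R) x y z g f.
apply: esym; refine (eq_trans h1 _).
exact: (congr1 (@qpi k (qcat_pre (@outer_id k R)) x z) h2).
Qed.

Lemma Lclass_add x y (g f : expr k x y) :
  Lclass (Add g f) = (Lclass g : hom L x y) + Lclass f.
Proof. by rewrite /Lclass /quotient_proj /qpi /= -plpiD /= -plpiD. Qed.

Lemma Lclass_scale x y c (f : expr k x y) :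
  Lclass (Scale c f) = c *: (Lclass f : hom L x y).
Proof. by rewrite /Lclass /quotient_proj /qpi /= -plpiZ /= -plpiZ. Qed.

Lemma Lclass_id x : Lclass (Id k x) = idm x :> hom L x x.
Proof. by []. Qed.

Lemma Lclass_zero x y : Lclass (Zero k x y) = 0 :> hom L x y.
Proof. by []. Qed.

Lemma hcomp0l (C : lincat k) (x y z : C) (f : hom C x y) :
  (0 : hom C y z) \oc f = 0.
Proof. by rewrite -[0 in LHS](scale0r 0) hcompZl scale0r. Qed.
Lemma hcomp0r (C : lincat k) (x y z : C) (f : hom C y z) :
  f \oc (0 : hom C x y) = 0.
Proof. by rewrite -[0 in LHS](scale0r 0) hcompZr scale0r. Qed.

Lemma cut_gen (y : L) (f : R -> R) (a b : R) (h : hom L (Some a) (Some b)) :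
  lipschitz1 f -> composite h `|a - b| ->
  forall g, cut_set y f (Some a) g -> cut_set y f (Some b) (h \oc g).
Proof.
move=> fL hc; apply: lin_span_ind.
- by rewrite hcomp0r; exact: lin_span0.
- by move=> u v hu hv; rewrite hcompDr; exact: lin_spanD.
move=> c g [l [fl [g0 gl]]]; rewrite hcompZr; apply: lin_spanZ.
have [->|hg] := pselect (h \oc g = 0); first exact: lin_span0.
apply: lin_span_in; exists (`|a - b| + l); split.
  by rewrite addrC; apply: le_trans (fL a b) _; rewrite lerD2r.
by split=> //; exact: composite_comp.
Qed.

Fact cut_act_expr (y : L) (f : R -> R) (fL : lipschitz1 f) (x z : L)
  (e : expr k x z) (v : hom L y x) :
  cut_set y f x v -> cut_set y f z (Lclass e \oc v).
Proof.
elim: e v => {x z} [x v|x w z g IHg h IHh v|x z v|x z g IHg h IHh v|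
  x z c g IHg v|a b ab v|a b ab v].
- by rewrite Lclass_id hcomp_idl.
- by rewrite Lclass_comp -hcompA => /IHh /IHg.
- by rewrite Lclass_zero hcomp0l => _; exact: lin_span0.
- by rewrite Lclass_add hcompDl => fv; apply: lin_spanD; [exact: IHg|exact: IHh].
- by rewrite Lclass_scale hcompZl => fv; apply: lin_spanZ; exact: IHg.
- by apply: cut_gen => //; exact: composite_alpha.
- by apply: cut_gen => //; rewrite distrC; exact: composite_alphas.
Qed.

Fact cut_act (y : L) (f : R -> R) (fL : lipschitz1 f) (x z : L)
  (h : hom L x z) (v : hom L y x) :
  cut_set y f x v -> cut_set y f z (h \oc v).
Proof. by have [e ->] := LclassP h; exact: cut_act_expr. Qed.

Definition cut_submodule (y : L) (f : R -> R) (fL : lipschitz1 f) :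
  submodule (representable y) :=
  @Submodule k L (representable y) (cut_set y f)
    (fun x => lin_span0 _) (fun x => @lin_spanD _ _ _)
    (fun x => @lin_spanZ _ _ _) (cut_act fL).

End Cut.

Section Permuton.
Variable R : realType.

Definition I01 : Type := set_type (`[0, 1]%classic : set R).
Definition I01_point : I01.
Proof. by exists 0; rewrite inE /= in_itv /= lexx ler01. Defined.
HB.instance Definition _ :=
  Topological.copy I01 (set_type (`[0, 1]%classic : set R)).
HB.instance Definition _ := isPointed.Build I01 I01_point.
Definition coord (s : I01) : R := set_val s.

Definition square_borel : set (set (I01 * I01)) := open.
Definition square : measurableType _ := g_sigma_algebraType square_borel.

(** [0,x] x [0,y], cut down to the unit square *)
Definition box (x y : R) : set square :=
  [set p : I01 * I01 | coord p.1 <= x /\ coord p.2 <= y].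

Record permuton := Permuton {
  permuton_measure :> {measure set square -> \bar R};
  permuton_fst : forall x, 0 <= x <= 1 -> permuton_measure (box x 1) = x%:E;
  permuton_snd : forall x, 0 <= x <= 1 -> permuton_measure (box 1 x) = x%:E }.

Definition permuton_fun (mu : permuton) (y x : R) : R :=
  - 2 * fine (mu (box x y)) + y + x.

Lemma coord_continuous : continuous coord.
Proof. exact: initial_continuous. Qed.

Lemma closed_box (x y : R) : closed (box x y : set (I01 * I01)).
Proof.
apply: closedI.
- apply: (closed_comp _ (@closed_le R x)) => p _.
  apply: continuous_comp; [exact: cvg_fst|exact: coord_continuous].
- apply: (closed_comp _ (@closed_le R y)) => p _.
  apply: continuous_comp; [exact: cvg_snd|exact: coord_continuous].
Qed.

Lemma measurable_box (x y : R) : measurable (box x y).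
Proof.
rewrite -[box x y]setCK; apply: measurableC; apply: sub_sigma_algebra.
by rewrite /square_borel openC; exact: closed_box.
Qed.

Lemma coord_itv (s : I01) : 0 <= coord s <= 1.
Proof. by have := set_valP s; rewrite /= in_itv. Qed.

Lemma permuton_fin (mu : permuton) (A : set square) :
  measurable A -> mu A \is a fin_num.
Proof.
move=> mA; rewrite ge0_fin_numE ?measure_ge0//.
apply: (@le_lt_trans _ _ (mu (box 1 1))); last first.
  by rewrite permuton_fst ?ltry// ler01 lexx.
apply: le_measure; rewrite ?inE//; first exact: measurable_box.
by move=> p _; case/andP: (coord_itv p.1); case/andP: (coord_itv p.2).
Qed.

Lemma permuton_strip (mu : permuton) (x : R) :
  mu (box x 1) = (Num.max 0 (Num.min x 1))%:E.
Proof.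
have [x0|x0] := ltP x 0.
  rewrite (_ : box x 1 = set0) ?measure0; last first.
    rewrite -subset0 => p [px _].
    by case/andP: (coord_itv p.1) => p0 _; move: (le_lt_trans px x0); rewrite ltNge p0.
  congr EFin; rewrite /Num.max /Num.min; case: ifPn => //; case: ifPn => ?; lra.
have [x1|x1] := leP x 1.
  rewrite permuton_fst ?x0 ?x1//; congr EFin.
  by rewrite max_r.
rewrite (_ : box x 1 = box 1 1) ?permuton_fst ?ler01 ?lexx// ?max_r//.
apply/seteqP; split => p [_ p2]; split=> //.
  by case/andP: (coord_itv p.1).
by case/andP: (coord_itv p.1) => _ /le_trans; apply; exact: ltW.
Qed.

Lemma box_mono (mu : permuton) (x z y : R) : x <= z ->
  fine (mu (box x y)) <= fine (mu (box z y)).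
Proof.
move=> xz; apply: fine_le; try (by apply: permuton_fin; exact: measurable_box).
apply: le_measure; rewrite ?inE; try exact: measurable_box.
by move=> p [p1 p2]; split=> //; exact: le_trans p1 xz.
Qed.

Lemma box_lip (mu : permuton) (x z y : R) : x <= z ->
  fine (mu (box z y)) - fine (mu (box x y)) <= z - x.
Proof.
move=> xz.
have mD : measurable (box z 1 `\` box x 1).
  by apply: measurableD; exact: measurable_box.
have sub : box z y `<=` box x y `|` (box z 1 `\` box x 1).
  move=> p [pz py]; have [px|px] := leP (coord p.1) x; first by left.
  right; split; first by split=> //; case/andP: (coord_itv p.2).
  by case=> /(lt_le_trans px); rewrite ltxx.
have h1 : (mu (box z y) <= mu (box x y) + mu (box z 1 `\` box x 1))%E.
  apply: le_trans (measureU2 _ _ _) => //; try exact: measurable_box.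
  apply: le_measure => //; rewrite ?inE; try exact: measurable_box.
  by apply: measurableU => //; exact: measurable_box.
have h2 : (mu (box z 1) = mu (box x 1) + mu (box z 1 `\` box x 1))%E.
  rewrite -measureU//; try exact: measurable_box; last exact: setDIK.
  congr (mu _); rewrite setDUK//.
  by move=> p [p1 p2]; split=> //; exact: le_trans p1 xz.
have fb (u v : R) : mu (box u v) \is a fin_num.
  by apply: permuton_fin; exact: measurable_box.
move: h1 h2; rewrite !permuton_strip -(fineK (permuton_fin mu mD)) -(fineK (fb z y)).
rewrite -(fineK (fb x y)) -!EFinD lee_fin => h1 [] h2.
move: h2; rewrite /Num.max /Num.min.
rewrite /=; case: (ltP x 1) => ?; case: (ltP z 1) => ?; case: ltP => ?;
  case: ltP => ? h2; lra.
Qed.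

Lemma permuton_fun_lipschitz (mu : permuton) (y : R) : lipschitz1 (permuton_fun mu y).
Proof.
move=> x z; rewrite /permuton_fun; have [xz|zx] := leP x z.
  by rewrite ler0_norm ?subr_le0//; have := box_mono mu y xz; lra.
by rewrite gtr0_norm ?subr_gt0//; have := box_lip mu y (ltW zx); lra.
Qed.

End Permuton.

Section PermutonIdeal.
Variables (k : fieldType) (R : realType).

Definition unit_pt : Type := {y : R | 0 < y < 1}.
Definition Lob (x : R) : Lambda k R := Some x.

Definition unit_proj (y : unit_pt) : cmod (Lambda k R) :=
  representable (Lob (sval y)).

Definition permuton_ideal (mu : permuton R) : submodule (dsum unit_proj) :=
  dsum_sub (fun y : unit_pt =>
    cut_submodule (Lob (sval y)) (@permuton_fun_lipschitz R mu (sval y))).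

End PermutonIdeal.

(* Main.v *)
Require Import Defs.
From HB Require Import structures.
From mathcomp Require Import all_boot all_order all_algebra.
From mathcomp Require Import all_classical all_reals all_analysis.
From mathcomp Require Import lra.

Set Implicit Arguments.
Unset Strict Implicit.
Unset Printing Implicit Defensive.

Import Order.TTheory GRing.Theory Num.Theory.
(* [hom] must denote the morphisms of a category, not those of vector.v *)
Import Defs.

Local Open Scope classical_set_scope.
Local Open Scope ring_scope.

(** The ideal [permuton_ideal k mu] is a direct sum, so inclusions are tested
    summand by summand. Fix [b] in (0,1). A composite of arrows from [b] to [a]
    is determined by its total descent [d] and its total ascent
    [u = a - b + d], and its length is [u + d]. Since ascents and descents
    commute, the composite may be rearranged so as to pass through the lowest
    point [b - d], or through the highest point [b + u]; it vanishes as soon as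
    one of them leaves (0,1). What survives are the lengths [l] with
    [|a - b| <= l < min (a + b) (2 - a - b)].

    For a permuton [mu] the Frechet bounds
    [max 0 (a + b - 1) <= mu (box a b) <= min a b] say exactly that
    [f_mu a = a + b - 2 mu (box a b)] lies in the closed interval
    [[|a - b|, min (a + b) (2 - a - b)]]. If [mu <= nu] on boxes then
    [f_nu <= f_mu], so long paths for [mu] are long for [nu]. If instead
    [f_mu a < f_nu a] at some [a], the path of length [f_mu a] is nonzero and
    belongs to the ideal of [mu]; it is not in the ideal of [nu], which in that
    place is spanned by strictly longer paths, because paths of different
    lengths are linearly independent.

    The substance is this last fact, a lower bound on a category given by
    generators and relations. It comes from a representation of [Lambda]:
    every expression acts on functions [R -> k], a function being read as the
    family of coefficients of the paths out of [b], indexed by descent ([act]).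
    The defining relations hold for this action ([act_sound]) and the objects
    outside (0,1) act by zero, so it descends to [Lambda] ([act_Lambda]), where
    a composite acts as a shift by its descent ([act_composite]). Reading one
    coefficient of the image of the trivial path gives a linear form [coef] that
    is 1 on the composites of one chosen length and 0 on all others
    ([coef_composite]). *)

(** * Shifting coefficients of paths out of [b] *)

Section PathModel.
Variables (k : fieldType) (R : realType) (b : R).
Notation L := (Lambda k R).

(** The paths from [b] to [x] of descent [d] that survive in [Lambda]: the
    descent must lie in [0, b) and the ascent [x + d - b] in [0, 1 - b). *)
Definition valid (x : vertex R) (d : R) : bool :=
  if x is Some x then (0 <= d < b) && (b <= x + d < 1) else false.

Lemma valid_inside x d : valid (Some x) d -> 0 < x < 1.
Proof. by rewrite /valid; lra. Qed.

(** A family of coefficients of the paths from [b] to some [x], indexed by the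
    descent. One space serves all [x], so that [act] needs no dependent types;
    [shift] discards the coefficients that are meaningless at [x]. *)
Definition coeffs := R -> k^o.

(** The action of an arrow from [x] to [y] of descent [s]: prolong every path
    ending at [x] by it, and forget the paths that do not survive. Forgetting
    at both ends makes [shift 0 x x] the projection onto the paths ending at
    [x], which is how the identity of [x] acts. *)
Definition shift (s : R) (x y : vertex R) (phi : coeffs) : coeffs :=
  fun d => if valid y d && valid x (d - s) then phi (d - s) else 0.

Lemma shiftD s x y phi psi :
  shift s x y (phi + psi) = shift s x y phi + shift s x y psi.
Proof.
by apply/funext => d; rewrite /shift !fctE; case: ifP => //; rewrite addr0.
Qed.

Lemma shiftZ s x y c phi : shift s x y (c *: phi) = c *: shift s x y phi.
Proof.
by apply/funext => d; rewrite /shift !fctE; case: ifP => //; rewrite scaler0.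
Qed.

Lemma shift_comp s t x y z phi :
  (forall d, valid z d -> valid x (d - (s + t)) -> valid y (d - t)) ->
  shift t y z (shift s x y phi) = shift (s + t) x z phi.
Proof.
move=> xyz; apply/funext => d; rewrite /shift.
rewrite (_ : d - t - s = d - (s + t)); last lra.
case: (boolP (valid z d)) => //= zd; case: (boolP (valid x _)) => xd.
  by rewrite (xyz d).
by rewrite andbF; case: ifP.
Qed.

(** Along an arrow neither descent nor ascent decreases, so a path with
    surviving beginning and end survives in between. *)
Lemma valid_convex s t x y z d :
  0 <= s -> 0 <= t -> x - y <= s -> y - z <= t ->
  valid (Some z) d -> valid (Some x) (d - (s + t)) -> valid (Some y) (d - t).
Proof. by rewrite /valid; lra. Qed.

(** This gives at once the composition of ascents, the composition of descents
    and their commutation, since it depends only on the endpoints and on the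
    total descent. *)
Lemma shift_comp_some s t x y z phi :
  0 <= s -> 0 <= t -> x - y <= s -> y - z <= t ->
  shift t (Some y) (Some z) (shift s (Some x) (Some y) phi) =
  shift (s + t) (Some x) (Some z) phi.
Proof. by move=> *; apply: shift_comp => d; exact: valid_convex. Qed.

(** * The representation of the category *)

Fixpoint act (x y : vertex R) (e : expr k x y) : coeffs -> coeffs :=
  match e with
  | Id x => shift 0 x x
  | Comp _ _ _ g f => act g \o act f
  | Zero _ _ => fun=> 0
  | Add _ _ f g => fun phi => act f phi + act g phi
  | Scale _ _ c f => fun phi => c *: act f phi
  | Up x y _ => shift 0 (Some x) (Some y)
  | Down x y _ => shift (y - x) (Some y) (Some x)
  end.

Lemma actD x y (e : expr k x y) phi psi :
  act e (phi + psi) = act e phi + act e psi.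
Proof.
elim: e phi psi => {x y} [x|x y z g IHg f IHf|x y|x y g IHg f IHf|x y c f IHf
  |? ? ?|? ? ?] phi psi /=; rewrite ?shiftD ?addr0 //.
- by rewrite IHf IHg.
- by rewrite IHf IHg addrACA.
- by rewrite IHf scalerDr.
Qed.

Lemma actZ x y (e : expr k x y) c phi : act e (c *: phi) = c *: act e phi.
Proof.
elim: e phi => {x y} [x|x y z g IHg f IHf|x y|x y g IHg f IHf|x y a f IHf
  |? ? ?|? ? ?] phi /=; rewrite ?shiftZ ?scaler0 //.
- by rewrite IHf IHg.
- by rewrite IHf IHg scalerDr.
- by rewrite IHf !scalerA mulrC.
Qed.

Lemma act0 x y (e : expr k x y) : act e 0 = 0.
Proof. by rewrite -[X in act e X](scale0r 0) actZ scale0r. Qed.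

Lemma shift_idl s x y phi : shift 0 y y (shift s x y phi) = shift s x y phi.
Proof.
by rewrite shift_comp ?addr0 // => d; rewrite subr0.
Qed.

Lemma shift_idr s x y phi : shift s x y (shift 0 x x phi) = shift s x y phi.
Proof. by rewrite shift_comp ?add0r. Qed.

Lemma act_idl x y (e : expr k x y) phi : shift 0 y y (act e phi) = act e phi.
Proof.
elim: e phi => {x y} [x|x y z g IHg f IHf|x y|x y g IHg f IHf|x y a f IHf
  |? ? ?|? ? ?] phi /=; rewrite ?shift_idl //.
- by apply/funext => d; rewrite /shift; case: ifP.
- by rewrite shiftD IHf IHg.
- by rewrite shiftZ IHf.
Qed.

Lemma act_idr x y (e : expr k x y) phi : act e (shift 0 x x phi) = act e phi.
Proof.
elim: e phi => {x y} [x|x y z g IHg f IHf|x y|x y g IHg f IHf|x y a f IHf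
  |? ? ?|? ? ?] phi /=; rewrite ?shift_idr // ?IHf ?IHg //.
Qed.

(** The unit laws hold because every expression begins and ends with a
    projection ([act_idl], [act_idr]), linearity is inherited from [shift], and
    [shift_comp_some] settles the relations between the arrows. *)
Lemma act_sound x y (e e' : expr k x y) : expr_eq e e' -> act e =1 act e'.
Proof.
elim=> {x y e e'} //=.
- by move=> x y f g _ fg phi; rewrite fg.
- by move=> x y f g h _ fg _ gh phi; rewrite fg gh.
- by move=> x y z g g' f f' _ gg _ ff phi /=; rewrite ff gg.
- by move=> x y f f' g g' _ ff _ gg phi; rewrite ff gg.
- by move=> x y c f f' _ ff phi; rewrite ff.
- by move=> x y f g h phi; rewrite addrA.
- by move=> x y f g phi; rewrite addrC.
- by move=> x y f phi; rewrite add0r.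
- by move=> x y f phi; rewrite scale0r.
- by move=> x y f phi; rewrite scale1r.
- by move=> x y c d f phi; rewrite scalerA.
- by move=> x y c f g phi; rewrite scalerDr.
- by move=> x y c d f phi; rewrite scalerDl.
- by move=> x y f phi /=; rewrite act_idl.
- by move=> x y f phi /=; rewrite act_idr.
- by move=> x y z g f f' phi /=; rewrite actD.
- by move=> x y z c g f phi /=; rewrite actZ.
- by move=> x _ phi; rewrite subrr.
- by move=> x y z xy yz xz phi /=; rewrite shift_comp_some ?addr0 //; lra.
- move=> x y z xy yz xz phi /=; rewrite shift_comp_some; [|lra..].
  by congr (shift _ _ _ _); lra.
- move=> x s t s0 t0 _ _ _ _ phi /=; rewrite !shift_comp_some; [|lra..].
  by congr (shift _ _ _ _); lra.
Qed.

(** The action is defined on representatives; [act_sound] makes the choice of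
    representative irrelevant. *)
Definition act_LambdaR (x y : vertex R) (f : hom (LambdaR k R) x y) :=
  act (plrepr f).

Lemma act_LambdaRE x y (e : expr k x y) :
  act_LambdaR (@qpi k (LambdaR_pre k R) x y e) =1 act e.
Proof.
move=> phi; apply: act_sound.
exact: (@plreprP k (@phom k (LambdaR_pre k R) x y) e).
Qed.

Lemma act_LambdaRD (x y : vertex R) (f g : hom (LambdaR k R) x y) phi :
  act_LambdaR (f + g) phi = act_LambdaR f phi + act_LambdaR g phi.
Proof. exact: (act_LambdaRE (Add (plrepr f) (plrepr g))). Qed.

Lemma act_LambdaRZ (x y : vertex R) c (f : hom (LambdaR k R) x y) phi :
  act_LambdaR (c *: f) phi = c *: act_LambdaR f phi.
Proof. exact: (act_LambdaRE (Scale c (plrepr f))). Qed.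

Lemma act_LambdaR_comp (x y z : vertex R) (g : hom (LambdaR k R) y z)
    (f : hom (LambdaR k R) x y) phi :
  act_LambdaR (g \oc f) phi = act_LambdaR g (act_LambdaR f phi).
Proof. exact: (act_LambdaRE (Comp (plrepr g) (plrepr f))). Qed.

(** No path survives at an object outside (0,1) by [valid_inside], so its
    identity acts by zero. *)
Lemma act_LambdaR_ideal (x y : vertex R) (f : hom (LambdaR k R) x y) :
  ideal_gen (@outer_id k R) f -> act_LambdaR f =1 fun=> 0.
Proof.
elim=> {x y f}.
- move=> _ _ _ [x x01] phi; rewrite act_LambdaRE /=.
  apply/funext => d; rewrite /shift subr0 andbb.
  by case: ifP => // /valid_inside.
- by move=> x y phi; rewrite act_LambdaRE.
- by move=> x y f g _ IHf _ IHg phi; rewrite act_LambdaRD IHf IHg addr0.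
- by move=> x y c f _ IHf phi; rewrite act_LambdaRZ IHf scaler0.
- move=> x y z g f _ IHf phi; rewrite act_LambdaR_comp IHf; exact: act0.
- by move=> x y z g f _ IHg phi; rewrite act_LambdaR_comp IHg.
Qed.

Definition act_Lambda (x y : L) (f : hom L x y) :=
  act_LambdaR (plrepr f).

Lemma act_LambdaE (x y : L) (e : expr k x y) : act_Lambda (Lclass e) =1 act e.
Proof.
move=> phi; rewrite -act_LambdaRE /act_Lambda.
set f := qpi _.
have h := @plreprP _ (qcat_phom (@outer_id k R) x y) f.
have := act_LambdaR_ideal h phi.
rewrite -scaleN1r act_LambdaRD act_LambdaRZ scaleN1r => /eqP.
by rewrite subr_eq0 => /eqP.
Qed.

Lemma act_LambdaD (x y : L) (f g : hom L x y) phi :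
  act_Lambda (f + g) phi = act_Lambda f phi + act_Lambda g phi.
Proof.
have [e ->] := LclassP f; have [e' ->] := LclassP g.
by rewrite -Lclass_add !act_LambdaE.
Qed.

Lemma act_LambdaZ (x y : L) c (f : hom L x y) phi :
  act_Lambda (c *: f) phi = c *: act_Lambda f phi.
Proof.
by have [e ->] := LclassP f; rewrite -Lclass_scale !act_LambdaE.
Qed.

Lemma act_Lambda_comp (x y z : L) (g : hom L y z) (f : hom L x y) phi :
  act_Lambda (g \oc f) phi = act_Lambda g (act_Lambda f phi).
Proof.
have [e ->] := LclassP f; have [e' ->] := LclassP g.
by rewrite -Lclass_comp !act_LambdaE.
Qed.

(** The length [l] of an arrow from [p] to [q] is its descent [s] plus its
    ascent [s + (q - p)]. Descents add up under composition, and no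
    condition at the intermediate objects remains, by [valid_convex]. *)
Lemma act_composite (x y : L) (f : hom L x y) l : composite f l ->
  exists p q (s : R), [/\ x = Some p, y = Some q, 0 <= s /\ p - q <= s,
    l = 2 * s + (q - p) & act_Lambda f =1 shift s x y].
Proof.
elim=> {x y f l}.
- move=> x y xy; exists x, y, 0; split=> //; try lra.
    by rewrite ler0_norm; lra.
  by move=> phi; rewrite act_LambdaE.
- move=> x y xy; exists y, x, (y - x); split=> //; try lra.
    by rewrite ler0_norm; lra.
  by move=> phi; rewrite act_LambdaE.
- move=> x y z g f l m _ [q [r [t [ey ez [t0 qr] -> gE]]]].
  move=> _ [p [q' [s [ex ey' [s0 pq] -> fE]]]]; subst x y z.
  case: ey' => ?; subst q'; exists p, r, (s + t); split=> //; try lra.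
  by move=> phi; rewrite act_Lambda_comp fE gE shift_comp_some.
Qed.

(** It suffices that the identity of the target vanishes: this is a generator
    of the ideal for a real outside (0,1), and a relation of the category for
    the zero object. *)
Lemma Lambda_outside (x y : L) (g : hom L x y) :
  (forall c, y = Some c -> ~ (0 < c < 1)) -> g = 0.
Proof.
move=> y01.
have idy0 : idm y = 0 :> hom L y y.
  case: y y01 g => [c c01|_] _.
    apply/plpiP; rewrite /= /ideal_eq subr0.
    by apply: ideal_gen_in; constructor; exact: c01.
  rewrite -Lclass_id -Lclass_zero /Lclass.
  by congr (quotient_proj _ _); apply/plpiP; exact: ee_zero_object.
by rewrite -(hcomp_idl g) idy0 hcomp0l.
Qed.

End PathModel.

(** * Inclusions between submodules of a representable module *)

Section CutInclusion.
Variables (k : fieldType) (R : realType).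
Notation L := (Lambda k R).

(** The two functions need to be compared only inside (0,1), for nothing but
    zero arrives at the other objects. *)
Lemma cut_set_le (y : L) (f g : R -> R) (x : L) :
  (forall c, 0 < c < 1 -> g c <= f c) ->
  cut_set (y := y) f (x := x) `<=` cut_set (y := y) g (x := x).
Proof.
move=> gf; apply: lin_span_ind; [exact: lin_span0|exact: lin_spanD|].
move=> a h; case: x h => [c|//] h [l [fl [h0 hl]]].
apply/lin_spanZ/lin_span_in; exists l; split=> //.
apply: le_trans fl; apply: gf; apply: contrapT => c01; apply: h0.
by apply: Lambda_outside => _ [<-].
Qed.

Section Coefficient.
Variables (a b l : R).

(** The coefficient, in a morphism from [b] to [a], of the path of length [l]:
    the morphism is applied to the trivial path at [b], whose descent is 0, and
    the result is read at the descent [(l - (a - b)) / 2] of a path of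
    length [l]. *)
Definition coef (g : hom L (Some b) (Some a)) : k^o :=
  act_Lambda b g (fun d => (d == 0)%:R) ((l - (a - b)) / 2).

Lemma coefD g h : coef (g + h) = coef g + coef h.
Proof. by rewrite /coef act_LambdaD. Qed.

Lemma coef0 : coef 0 = 0.
Proof. by rewrite -(scale0r 0) /coef act_LambdaZ scale0r. Qed.

Lemma coefZ c g : coef (c *: g) = c *: coef g.
Proof. by rewrite /coef act_LambdaZ. Qed.

Lemma coef_composite g m :
  `|a - b| <= l -> 0 < b < 1 -> l < a + b -> l < 2 - a - b ->
  composite g m -> coef g = (m == l)%:R.
Proof.
rewrite ler_norml => abl b01 lab lab2.
move=> /(act_composite b) [_ [_ [s [[<-] [<-] [s0 bas] -> gE]]]].
rewrite /coef gE /shift; set d := _ / 2.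
have [sl|sl] := eqVneq (2 * s + (a - b)) l.
  have -> : d - s = 0 by rewrite /d; lra.
  by rewrite eqxx ifT // /valid /= /d; lra.
rewrite (_ : d - s == 0 = false) ?if_same //.
by apply: contraNF sl => /eqP ds; apply/eqP; move: ds; rewrite /d; lra.
Qed.

Lemma exists_composite :
  `|a - b| <= l -> exists g : hom L (Some b) (Some a), composite g l.
Proof.
rewrite ler_norml => abl.
(* descend from b to c, then ascend to a: (b - c) + (a - c) = l *)
pose c := b - (l - (a - b)) / 2.
have cb : c <= b by rewrite /c; lra.
have ca : c <= a by rewrite /c; lra.
exists (alpha k ca \oc alphas k cb).
rewrite (_ : l = `|c - a| + `|c - b|).
  apply: composite_comp; [exact: composite_alpha|exact: composite_alphas].
by rewrite !ler0_norm /c; lra.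
Qed.

End Coefficient.

(** The bounds on [f a] put the path of length [f a] among the surviving ones;
    its coefficient is 1, whereas that of all longer paths is 0. *)
Lemma cut_set_le_conv (f g : R -> R) (a b : R) :
  0 < b < 1 -> `|a - b| <= f a -> f a < Num.min (a + b) (2 - a - b) ->
  cut_set (y := Some b : L) f (x := Some a) `<=`
    cut_set (y := Some b : L) g (x := Some a) ->
  g a <= f a.
Proof.
move=> b01 abf; rewrite lt_min => /andP[fab fab2] fg.
have [w wf] := exists_composite abf.
have w1 : coef (f a) w = 1.
  by rewrite (coef_composite abf b01 fab fab2 wf) eqxx.
have {fg} : cut_set (y := Some b : L) g (x := Some a) w.
  apply: fg; apply: lin_span_in; exists (f a); split=> //; split=> // w0.
  by move: w1; rewrite w0 coef0 => /eqP; rewrite eq_sym oner_eq0.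
rewrite leNgt => gw; apply/negP => fga; move: gw w1.
suff w0 : forall v, cut_set (y := Some b : L) g (x := Some a) v ->
    coef (f a) v = 0.
  by move=> /w0 -> /eqP; rewrite eq_sym oner_eq0.
apply: lin_span_ind.
- exact: coef0.
- by move=> u v; rewrite coefD => -> ->; rewrite addr0.
move=> c v [m [gm [_ vm]]]; rewrite coefZ (coef_composite abf b01 fab fab2 vm).
by rewrite gt_eqF ?scaler0 //; exact: lt_le_trans gm.
Qed.

End CutInclusion.

(** * Inclusions between submodules of a direct sum *)

Section DirectSumInclusion.
Variables (k : pzRingType) (C : lincat k) (I : Type) (M : I -> cmod C).

(** The inclusion of one summand; [M j] depends on [j], hence the transport. *)
Definition single_fun (x : C) (i : I) (v : M i x) (j : I) : M j x :=
  if pselect (i = j) is left ij then ecast j (M j x) ij v else 0.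

Lemma single_fin (x : C) (i : I) (v : M i x) :
  finite_set [set j | single_fun v j <> 0].
Proof.
apply: (@sub_finite_set _ _ [set i]) => // j; rewrite /single_fun /=.
by case: pselect.
Qed.

Definition single (x : C) (i : I) (v : M i x) : dsum M x :=
  exist _ (single_fun v) (single_fin v).

Lemma single_same (x : C) (i : I) (v : M i x) : fs_val (single v) i = v.
Proof.
rewrite /fs_val /= /single_fun; case: pselect => // ii.
by rewrite (Prop_irrelevance ii erefl).
Qed.

Lemma dsum_sub_le (S T : forall i, submodule (M i)) :
  sub_le (dsum_sub S) (dsum_sub T) <-> forall i, sub_le (S i) (T i).
Proof.
split=> [ST i x v Sv|ST x v Sv i]; last exact/ST/Sv.
rewrite -(single_same v); apply: ST => j /=.
rewrite /fs_val /= /single_fun; case: pselect => [ij|_]; last exact: sm0.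
by case: _ / ij.
Qed.

End DirectSumInclusion.

(** * Frechet bounds for permutons *)

Section PermutonBounds.
Variables (R : realType) (mu : permuton R).

Lemma box_fin (x y : R) : mu (box x y) \is a fin_num.
Proof. by apply: permuton_fin; exact: measurable_box. Qed.

(** The lower bound [x + y - 1] comes from [mu (box 1 y) = y], because widening
    a box adds at most the added width. *)
Lemma box_bounds (x y : R) : 0 < x < 1 -> 0 < y < 1 ->
  Num.max 0 (x + y - 1) <= fine (mu (box x y)) <= Num.min x y.
Proof.
move=> x01 y01; rewrite ge_max le_min fine_ge0 ?measure_ge0 //=.
have x1 : x <= 1 by lra.
have mu1y : fine (mu (box 1 y)) = y by rewrite permuton_snd //; lra.
have := box_lip mu y x1; have := box_mono mu y x1; rewrite mu1y => xy1 lip.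
rewrite xy1 andbT; apply/andP; split; first lra.
rewrite -[leRHS](_ : fine (mu (box x 1)) = x); last first.
  by rewrite permuton_fst //; lra.
apply: fine_le; try exact: box_fin.
apply: le_measure; rewrite ?inE; try exact: measurable_box.
by move=> p [p1 p2]; split=> //; case/andP: (coord_itv p.2).
Qed.

Lemma permuton_fun_bounds (x y : R) : 0 < x < 1 -> 0 < y < 1 ->
  `|x - y| <= permuton_fun mu y x <= Num.min (x + y) (2 - x - y).
Proof.
move=> x01 y01; have := box_bounds x01 y01; rewrite ge_max !le_min ler_norml.
by rewrite /permuton_fun; lra.
Qed.

End PermutonBounds.

Lemma permuton_fun_le (R : realType) (mu nu : permuton R) (x y : R) :
  (permuton_fun nu y x <= permuton_fun mu y x) =
  (mu (box x y) <= nu (box x y))%E.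
Proof.
rewrite -(fineK (box_fin mu x y)) -(fineK (box_fin nu x y)) lee_fin.
by rewrite /permuton_fun; apply/idP/idP; lra.
Qed.

(** * Inclusion of permuton ideals *)

Theorem proposition9p1 (k : closedFieldType) (R : realType)
    (mu nu : permuton R) :
  sub_le (permuton_ideal k mu) (permuton_ideal k nu) <->
  (forall a b : R, 0 < a < 1 -> 0 < b < 1 ->
     (mu (box a b) <= nu (box a b))%E).
Proof.
split=> [|munu]; last first.
  apply/dsum_sub_le => -[b b01] x /=; apply: cut_set_le => a a01.
  by rewrite permuton_fun_le; exact: munu.
move=> /dsum_sub_le sub a b a01 b01; rewrite -permuton_fun_le leNgt.
apply/negP => lt_fun.
have /andP[mu_ge _] := permuton_fun_bounds mu a01 b01.
have /andP[_ nu_le] := permuton_fun_bounds nu a01 b01.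
have := cut_set_le_conv b01 mu_ge (lt_le_trans lt_fun nu_le)
  (sub (exist _ b b01) (Some a)).
by rewrite leNgt lt_fun.
Qed.
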